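(* Let $\mathcal{N}$ be a model of the base theory $F$ ($=\mathrm{RCA}_0^*$) and let $n$ be a natural number. Consider these statements in $\mathcal{N}$: (a) Every finite union of finite $\Sigma^0_{n+1}$-definable sets is finite. (b) The Infinite $\Sigma^0_{n+1}$-Pigeonhole Principle holds. Then (a) implies (b); and if, in addition, $\mathcal{N}$ realizes $\mathrm{B}\Sigma^0_n$, then (b) implies (a).
   Context: Setting: $\mathcal{N}=(N,\mathcal{P},+,\times,<,0,1)$ with $\mathcal{P}\subseteq 2^N$ is a (possibly nonstandard) second-order model of arithmetic; elements of $N$ are called integers and elements of $\mathcal{P}$ are called sets. $\mathcal{N}$ satisfies the base theory $F$, consisting of $P^-$ (Peano arithmetic without induction), $\mathrm{I}\Delta^0_0$, the totality of exponentiation, and $\Delta^0_1$-comprehension; $F$ is also called $\mathrm{RCA}_0^*$. A formula is $\Delta^0_0$ ($=\Sigma^0_0=\Pi^0_0$) if all its quantifiers are bounded number quantifiers; $\Sigma^0_{n+1}$ formulas are a block of existential number quantifiers followed by a $\Pi^0_n$ formula, and dually for $\Pi^0_{n+1}$. Number and set parameters are allowed. Here $n$ is a (standard) natural number indexing formula classes. A definable subset of $N$ (not necessarily in $\mathcal{P}$) is finite iff it is bounded by some integer of $N$, and infinite otherwise. A finite collection of $\Sigma^0_{n+1}$-definable sets is a uniformly $\Sigma^0_{n+1}$-definable family $\{A_i\mid i<k\}$ with $k\in N$ possibly nonstandard, i.e. ''$x\in A_i$'' is given by a $\Sigma^0_{n+1}$ formula in $x$ and $i$. The Infinite $\Gamma$-Pigeonhole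 Principle asserts: if $C$ is a partial function from $N$ to some integer $k$ whose graph is $\Gamma$-definable in $\mathcal{N}$, and $X$ is an infinite subset of the domain of $C$, then there is $x<k$ such that $C^{-1}(x)\cap X$ is infinite in $\mathcal{N}$. $\mathrm{B}\Sigma^0_m$ is the scheme asserting, for every $\Sigma^0_m$ formula $P(i,b)$ and all $r\in N$: if $\forall i<r\,\exists b_i\,P(i,b_i)$ then $\exists b\,\forall i<r\,\exists b_i<b\,P(i,b_i)$. *)

(* Defs.v *)
From mathcomp Require Import all_boot.

Set Implicit Arguments.
Unset Strict Implicit.
Unset Printing Implicit Defensive.

(* Structures (N, P, +, *, <, 0, 1) with P a collection of subsets of N. *)
Record so_structure := SOStructure {
  num :> Type;
  is_set : (num -> Prop) -> Prop;
  add : num -> num -> num;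
  mul : num -> num -> num;
  lt : num -> num -> Prop;
  zero : num;
  one : num
}.

Declare Scope so_scope.
Delimit Scope so_scope with so.
Notation "x + y" := (add x y) : so_scope.
Notation "x * y" := (mul x y) : so_scope.
Notation "x < y" := (lt x y) : so_scope.
Notation "0" := (zero _) : so_scope.
Notation "1" := (one _) : so_scope.
Local Open Scope so_scope.

(* Formulas without set quantifiers. Number variables are de Bruijn indices.  *)
(* Set parameters occur as constants (in Mem); number parameters are the      *)
(* values that the valuation gives to the remaining free variables.           *)

Inductive term :=
  | Var of nat
  | Zero
  | One
  | Add of term & term
  | Mul of term & term.

(* AllB t p and ExB t p are the bounded quantifiers; the bound t is outside   *)
(* the scope of the quantified variable.                                      *)
Inductive form (M : so_structure) :=
  | Eq of term & term
  | Lt of term & term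
  | Mem of term & {X : M -> Prop | is_set X}
  | Neg of form M
  | And of form M & form M
  | Or of form M & form M
  | Imp of form M & form M
  | AllB of term & form M
  | ExB of term & form M
  | All of form M
  | Ex of form M.

Definition scons (M : so_structure) (a : M) (v : nat -> M) : nat -> M :=
  fun j => if j is j'.+1 then v j' else a.
Notation "a .: v" := (scons a v) (at level 55, right associativity) : so_scope.

Fixpoint eval (M : so_structure) (v : nat -> M) (t : term) : M :=
  match t with
  | Var j => v j
  | Zero => 0
  | One => 1
  | Add s t => eval v s + eval v t
  | Mul s t => eval v s * eval v t
  end.

Fixpoint sat (M : so_structure) (v : nat -> M) (p : form M) : Prop :=
  match p with
  | Eq s t => eval v s = eval v t
  | Lt s t => eval v s < eval v t
  | Mem t X => proj1_sig X (eval v t)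
  | Neg p => ~ sat v p
  | And p q => sat v p /\ sat v q
  | Or p q => sat v p \/ sat v q
  | Imp p q => sat v p -> sat v q
  | AllB t p => forall a, a < eval v t -> sat (a .: v) p
  | ExB t p => exists a, a < eval v t /\ sat (a .: v) p
  | All p => forall a, sat (a .: v) p
  | Ex p => exists a, sat (a .: v) p
  end.

Fixpoint Delta0 (M : so_structure) (p : form M) : Prop :=
  match p with
  | Eq _ _ | Lt _ _ | Mem _ _ => True
  | Neg p | AllB _ p | ExB _ p => Delta0 p
  | And p q | Or p q | Imp p q => Delta0 p /\ Delta0 q
  | All _ | Ex _ => False
  end.

Fixpoint Sigma (M : so_structure) (n : nat) (p : form M) : Prop :=
  if n is m.+1 then exists k q, p = iter k (@Ex M) q /\ Pi m q else Delta0 p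
with Pi (M : so_structure) (n : nat) (p : form M) : Prop :=
  if n is m.+1 then exists k q, p = iter k (@All M) q /\ Sigma m q
  else Delta0 p.

Definition definable2 (M : so_structure) (Gamma : form M -> Prop)
    (R : M -> M -> Prop) : Prop :=
  exists (p : form M) (v : nat -> M),
    Gamma p /\ forall x y, R x y <-> sat (x .: y .: v) p.

Record Pminus (M : so_structure) : Prop := {
  addA : forall x y z : M, (x + y) + z = x + (y + z);
  addC : forall x y : M, x + y = y + x;
  mulA : forall x y z : M, (x * y) * z = x * (y * z);
  mulC : forall x y : M, x * y = y * x;
  mulD : forall x y z : M, x * (y + z) = x * y + x * z;
  add0 : forall x : M, x + 0 = x;
  mul0 : forall x : M, x * 0 = 0;
  mul1 : forall x : M, x * 1 = x;
  lt_trans : forall x y z : M, x < y -> y < z -> x < z;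
  lt_irrefl : forall x : M, ~ x < x;
  lt_total : forall x y : M, x < y \/ x = y \/ y < x;
  lt_add : forall x y z : M, x < y -> x + z < y + z;
  lt_mul : forall x y z : M, 0 < z -> x < y -> x * z < y * z;
  lt_diff : forall x y : M, x < y -> exists z, x + z = y;
  lt01 : (0 : M) < 1;
  one_least : forall x : M, 0 < x -> x = 1 \/ 1 < x;
  zero_least : forall x : M, x = 0 \/ 0 < x
}.

Definition IDelta0 (M : so_structure) : Prop :=
  forall (p : form M) (v : nat -> M), Delta0 p ->
    sat (0 .: v) p ->
    (forall x, sat (x .: v) p -> sat ((x + 1) .: v) p) ->
    forall x, sat (x .: v) p.

(* Goedel's beta function: r is the remainder of a modulo 1 + (i + 1) * b. *)
Definition beta (M : so_structure) (a b i r : M) : Prop :=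
  r < 1 + (i + 1) * b /\ exists q, a = q * (1 + (i + 1) * b) + r.

(* z = x ^ y: some (a, b) codes the sequence x ^ 0, x ^ 1, ..., x ^ y. Over   *)
(* Pminus and IDelta0, totality of this relation is equivalent to totality of *)
(* the exponential function given by its usual Delta0 graph.                  *)
Definition is_exp (M : so_structure) (x y z : M) : Prop :=
  exists a b : M,
    beta a b 0 1 /\
    (forall i u, i < y -> beta a b i u -> beta a b (i + 1) (u * x)) /\
    beta a b y z.

Definition exp_total (M : so_structure) : Prop :=
  forall x y : M, exists z, is_exp x y z.

Definition Delta1_comprehension (M : so_structure) : Prop :=
  forall (p q : form M) (v : nat -> M), Sigma 1 p -> Pi 1 q ->
    (forall x, sat (x .: v) p <-> sat (x .: v) q) ->
    exists X : M -> Prop, is_set X /\ forall x, X x <-> sat (x .: v) p.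

Record RCA0star (M : so_structure) : Prop := {
  RCA0star_Pminus : Pminus M;
  RCA0star_IDelta0 : IDelta0 M;
  RCA0star_exp : exp_total M;
  RCA0star_comprehension : Delta1_comprehension M
}.

(* Internal finiteness: A need not be externally finite, nor a set of M. *)
Definition finite (M : so_structure) (A : M -> Prop) : Prop :=
  exists b : M, forall x, A x -> x < b.

Definition infinite (M : so_structure) (A : M -> Prop) : Prop := ~ finite A.

(* A i x stands for x \in A_i; the number k of sets may be nonstandard. *)
Definition finite_unions_finite (M : so_structure) (Gamma : form M -> Prop) :
    Prop :=
  forall (A : M -> M -> Prop) (k : M), definable2 Gamma A ->
    (forall i, i < k -> finite (A i)) ->
    finite (fun x => exists i, i < k /\ A i x).

(* C is the graph of the partial function; X is a set of the structure. *)
Definition infinite_pigeonhole (M : so_structure) (Gamma : form M -> Prop) :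
    Prop :=
  forall (C : M -> M -> Prop) (k : M) (X : M -> Prop),
    definable2 Gamma C ->
    (forall x y y', C x y -> C x y' -> y = y') ->
    (forall x y, C x y -> y < k) ->
    is_set X -> infinite X -> (forall x, X x -> exists y, C x y) ->
    exists c, c < k /\ infinite (fun x => C x c /\ X x).

Definition BSigma (M : so_structure) (m : nat) : Prop :=
  forall (P : M -> M -> Prop) (r : M), definable2 (@Sigma M m) P ->
    (forall i, i < r -> exists b, P i b) ->
    exists b, forall i, i < r -> exists b', b' < b /\ P i b'.

(* Main.v *)
Require Import Defs.
From mathcomp Require Import all_boot.
From Stdlib Require Import Classical FunctionalExtensionality PropExtensionality.

(* If finitely many finite sets A_i (i < k) have infinite union, colour w by    *)
(* the least index i occurring in a triple (i, x, b) with x >= w and b a        *)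
(* witness of x in A_i, the triples being taken below the least possible bound. *)
(* An infinite colour class makes A_i unbounded. The colouring is               *)
(* Sigma_{n+1} as soon as Pi_n relations are closed under bounded quantifiers   *)
(* and have the least number property. Both follow by induction on n from the   *)
(* pigeonhole principle itself: at level n the argument yields the union        *)
(* principle for Sigma_{n+1} sets, which gives collection (the complements of   *)
(* upward closed sets of bounds are finite, so a common bound exists), hence    *)
(* the two closure properties at level n + 1.                                   *)

Section Definability.
Set Implicit Arguments.
Unset Strict Implicit.
Context (M : so_structure).

Local Notation "x ≺ y" := (lt x y) (at level 70).
Local Notation "0_M" := (Defs.zero M).
Local Notation "x +1" := (Defs.add x (Defs.one M)) (at level 50).
Local Notation "a .: v" := (scons a v) (at level 55, right associativity).

Implicit Types (p q : form M) (u v : nat -> M) (R S Q : (nat -> M) -> Prop).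

Lemma rel_ext R S : (forall v, R v <-> S v) -> R = S.
Proof.
by move=> RS; apply: functional_extensionality => v; apply: propositional_extensionality.
Qed.

(** * Renaming of variables *)

Fixpoint ren_term (r : nat -> nat) (t : term) : term :=
  match t with
  | Var j => Var (r j)
  | Zero => Zero
  | One => One
  | Add s t => Add (ren_term r s) (ren_term r t)
  | Mul s t => Mul (ren_term r s) (ren_term r t)
  end.

Definition up (r : nat -> nat) (j : nat) : nat := if j is i.+1 then (r i).+1 else 0.

Fixpoint ren (r : nat -> nat) p : form M :=
  match p with
  | Eq s t => Eq M (ren_term r s) (ren_term r t)
  | Lt s t => Lt M (ren_term r s) (ren_term r t)
  | Defs.Mem t X => Defs.Mem (ren_term r t) X
  | Neg p => Neg (ren r p)
  | And p q => And (ren r p) (ren r q)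
  | Or p q => Or (ren r p) (ren r q)
  | Imp p q => Imp (ren r p) (ren r q)
  | AllB t p => AllB (ren_term r t) (ren (up r) p)
  | ExB t p => ExB (ren_term r t) (ren (up r) p)
  | All p => All (ren (up r) p)
  | Ex p => Ex (ren (up r) p)
  end.

Lemma eval_ren r v t : eval v (ren_term r t) = eval (fun j => v (r j)) t.
Proof. by elim: t => //= s -> t ->. Qed.

Lemma scons_up r a v : (fun j => (a .: v) (up r j)) = a .: (fun j => v (r j)).
Proof. by apply: functional_extensionality; case. Qed.

Lemma sat_ren p r v : sat v (ren r p) = sat (fun j => v (r j)) p.
Proof.
elim: p r v => [s t|s t|t X|p IHp|p IHp q IHq|p IHp q IHq|p IHp q IHq|t p IHp|t p IHp
  |p IHp|p IHp] r v /=; rewrite ?eval_ren ?IHp ?IHq //.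
- apply: propositional_extensionality.
  by split=> H a /H; rewrite IHp scons_up.
- apply: propositional_extensionality.
  by split=> -[a [lta H]]; exists a; split=> //; move: H; rewrite IHp scons_up.
- apply: propositional_extensionality.
  by split=> H a; move: (H a); rewrite IHp scons_up.
- apply: propositional_extensionality.
  by split=> -[a H]; exists a; move: H; rewrite IHp scons_up.
Qed.

Lemma Delta0_ren p r : Delta0 p -> Delta0 (ren r p).
Proof.
by elim: p r => //= [p IHp q IHq|p IHp q IHq|p IHp q IHq|t p IHp|t p IHp] r;
  [case=> /IHp Hp /IHq Hq; split..|apply: IHp|apply: IHp].
Qed.

Lemma ren_iter (B : form M -> form M) k p r :
  (forall r q, ren r (B q) = B (ren (up r) q)) ->
  ren r (iter k B p) = iter k B (ren (iter k up r) p).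
Proof. by move=> HB; elim: k r => //= k IH r; rewrite HB IH -iterSr. Qed.

(** * The arithmetical hierarchy on formulas *)

(* [s] selects Sigma ([true]) or Pi ([false]). *)
Definition hier (s : bool) (n : nat) p := if s then Sigma n p else Pi n p.

Definition quant (s : bool) : form M -> form M := if s then @Ex M else @All M.

Lemma hierS s n p :
  hier s n.+1 p <-> exists k q, p = iter k (quant s) q /\ hier (~~ s) n q.
Proof. by case: s. Qed.

Lemma hier0 s p : hier s 0 p <-> Delta0 p.
Proof. by case: s. Qed.

Lemma hier_ren s n p r : hier s n p -> hier s n (ren r p).
Proof.
elim: n s p r => [|n IH] s p r; first by rewrite !hier0; apply: Delta0_ren.
move=> /hierS [k [q [-> Hq]]]; apply/hierS; exists k, (ren (iter k up r) q).
by split; [rewrite ren_iter //; case: s {Hq} | apply: IH].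
Qed.

(** [Neg] may not stand before an unbounded quantifier at any level, so the negation is pushed
    through the prefix down to the matrix, by classical duality. *)
Lemma hier_neg s n p :
  hier s n p -> exists q, hier (~~ s) n q /\ forall v, sat v q <-> ~ sat v p.
Proof.
elim: n s p => [|n IH] s p.
  by move=> /hier0 Hp; exists (Neg p); split=> //; apply/hier0.
move=> /hierS [k [q [-> /IH [q' [Hq' Eq']]]]].
exists (iter k (quant (~~ s)) q'); split; first by apply/hierS; exists k, q'.
elim: k => //= k IHk v; case: s {Hq'} IHk => /= IHk.
  split=> [H [a]|H a]; first by apply/IHk.
  by apply/IHk => Ha; apply: H; exists a.
split=> [[a /IHk H] //|/not_all_ex_not [a Ha]].
by exists a; apply/IHk.
Qed.

Lemma hier_switch s n p : hier (~~ s) n p -> hier s n.+1 p.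
Proof. by move=> Hp; apply/hierS; exists 0, p. Qed.

(** The given blocks are kept and an empty one is added innermost, next to the matrix. *)
Lemma hier_succ s n p : hier s n p -> hier s n.+1 p.
Proof.
elim: n s p => [|n IH] s p.
  by move=> /hier0 Hp; apply: hier_switch; apply/hier0.
by move=> /hierS [k [q [-> /IH Hq]]]; apply/hierS; exists k, q.
Qed.

(** * Definable relations on valuations *)

(** Closing each level under logical equivalence frees later arguments from the prenex shape. *)
Definition arith s n R := exists p, hier s n p /\ forall v, R v <-> sat v p.

Lemma arith_iff s n R S : arith s n R -> (forall v, R v <-> S v) -> arith s n S.
Proof. by move=> HR /rel_ext <-. Qed.

Lemma arithN s n R : arith s n R -> arith (~~ s) n (fun v => ~ R v).
Proof.
move=> [p [/hier_neg [q [Hq Eq]] ER]]; exists q; split=> // v.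
by rewrite Eq ER.
Qed.

Lemma arithNN s n R : arith (~~ s) n (fun v => ~ R v) -> arith s n R.
Proof.
move/arithN; rewrite negbK => /arith_iff H; apply: H => v.
by split=> [/NNPP //|Rv []].
Qed.

Lemma arithS s n R : arith s n R -> arith s n.+1 R.
Proof.
by move=> [p [/hier_succ Hp ER]]; exists p.
Qed.

Lemma arith_switch s n R : arith (~~ s) n R -> arith s n.+1 R.
Proof.
by move=> [p [/hier_switch Hp ER]]; exists p.
Qed.

Lemma arith_ren s n R (f : (nat -> M) -> nat -> M) r :
  arith s n R -> (forall v j, f v j = v (r j)) -> arith s n (fun v => R (f v)).
Proof.
move=> [p [/(hier_ren r) Hp ER]] Ef; exists (ren r p); split=> // v.
by rewrite sat_ren ER; have -> : f v = (fun j => v (r j)) by apply: functional_extensionality.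
Qed.

Lemma arith_tail s n R : arith s n R -> arith s n (fun v => R (fun j => v j.+1)).
Proof. by move=> HR; apply: arith_ren HR _ => v j. Qed.

Lemma arith_ex n R : arith true n.+1 R -> arith true n.+1 (fun v => exists a, R (a .: v)).
Proof.
move=> [_ [[k [q [-> Hq]]] ER]]; exists (iter k.+1 (@Ex M) q); split.
  by exists k.+1, q.
by move=> v; split=> -[a /ER Ha]; exists a.
Qed.

Lemma sigma_ind n (K : ((nat -> M) -> Prop) -> Prop) :
  (forall R, arith false n R -> K R) ->
  (forall R, K R -> K (fun v => exists a, R (a .: v))) ->
  forall R, arith true n.+1 R -> K R.
Proof.
move=> K0 KE R [_ [[k [q [-> Hq]]] ER]].
rewrite (rel_ext ER) {R ER}; elim: k => [|k IH]; last exact: KE IH.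
by apply: K0; exists q.
Qed.

Lemma arith_Delta0 s n p : Delta0 p -> arith s n (fun v => sat v p).
Proof.
by move=> Hp; elim: n => [|n /arithS //]; exists p; split=> //; apply/hier0.
Qed.

(** Both connectives go in one induction because De Morgan exchanges them when passing from Sigma to
    Pi. Existential quantifiers are pulled out of one argument and then the other; for disjunctions
    [0_M] serves as dummy witness. *)
Lemma arith_and_or n R S : arith true n R -> arith true n S ->
  arith true n (fun v => R v /\ S v) /\ arith true n (fun v => R v \/ S v).
Proof.
elim: n R S => [|n IH] R S.
  move=> [p [Hp ER]] [q [Hq ES]].
  by split; [exists (And p q) | exists (Or p q)]; split=> // v; rewrite ER ES.
have base R1 R2 : arith false n R1 -> arith false n R2 ->
    arith true n.+1 (fun v => R1 v /\ R2 v) /\ arith true n.+1 (fun v => R1 v \/ R2 v).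
  move=> /arithN H1 /arithN H2; have [Ha Ho] := IH _ _ H1 H2.
  split; apply: arith_switch; apply: arithNN => /=.
    apply: (arith_iff Ho) => v.
    by split=> [[? []|? []] //|/not_and_or].
  apply: (arith_iff Ha) => v.
  by split=> [[? ?] []|/not_or_and].
have mixed T : arith true n.+1 T -> forall Q, arith false n Q ->
    arith true n.+1 (fun v => Q v /\ T v) /\ arith true n.+1 (fun v => Q v \/ T v).
  move: T; apply: (@sigma_ind n) => T HT Q HQ; first exact: base.
  have [/arith_ex Ha /arith_ex Ho] := HT _ (arith_tail HQ).
  split; [apply: (arith_iff Ha) => v|apply: (arith_iff Ho) => v].
    by split=> [[a [? ?]]|[? [a ?]]]; [split=> //; exists a|exists a].
  split=> [[a [?|?]]|[?|[a ?]]]; [by left|by right; exists a| |by exists a; right].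
  by exists 0_M; left.
move=> HR; move: R HR S; apply: (@sigma_ind n) => R HR S HS.
  exact: mixed.
have [/arith_ex Ha /arith_ex Ho] := HR _ (arith_tail HS).
split; [apply: (arith_iff Ha) => v|apply: (arith_iff Ho) => v].
  by split=> [[a [? ?]]|[[a ?] ?]]; [split=> //; exists a|exists a].
split=> [[a [?|?]]|[[a ?]|?]]; [by left; exists a|by right|by exists a; left|].
by exists 0_M; right.
Qed.

Lemma arith_and s n R S : arith s n R -> arith s n S -> arith s n (fun v => R v /\ S v).
Proof.
case: s => [HR HS|/arithN HR /arithN HS]; first by case: (arith_and_or HR HS).
apply: arithNN => /=; have [_ /arith_iff H] := arith_and_or HR HS; apply: H => v.
by split=> [[? []|? []] //|/not_and_or].
Qed.

Lemma arith_lt s n i j : arith s n (fun v => v i ≺ v j).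
Proof. exact: (arith_Delta0 s n (p := Lt M (Var i) (Var j))). Qed.

Lemma arith_exB n R j : arith true n R ->
  arith true n (fun v => exists a, a ≺ v j /\ R (a .: v)).
Proof.
case: n => [[p [Hp ER]]|n HR].
  exists (ExB (Var j) p); split=> // v.
  by split=> -[a [lta /ER Ha]]; exists a.
exact: (arith_ex (arith_and (arith_lt true n.+1 0 j.+1) HR)).
Qed.

Lemma arith_allB n R j : arith false n R ->
  arith false n (fun v => forall a, a ≺ v j -> R (a .: v)).
Proof.
move/arithN/(arith_exB j)/arith_iff => H; apply: arithNN; apply: H => v.
split=> [[a [lta Ha]] H|/not_all_ex_not [a Ha]]; first exact: Ha (H a lta).
by exists a; apply: imply_to_and.
Qed.

Lemma arith_definable2 n R v : arith true n R ->
  definable2 (@Sigma M n) (fun x y => R (x .: y .: v)).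
Proof. by move=> [p [Hp ER]]; exists p, v. Qed.

(* Applies, by conversion, to valuations of the form v i .: ... .: (fun j => v (k + j)). *)
Lemma arith_subst s n R (l : seq nat) k : arith s n R ->
  arith s n (fun v => R (foldr (fun i w => v i .: w) (fun j => v (k + j)) l)).
Proof.
pose r := foldr (fun i f j => if j is j'.+1 then f j' else i) (addn k) l.
move=> HR; apply: (arith_ren (r := r) HR) => v.
by rewrite {}/r; elim: l => [|i l IH] // [].
Qed.

(** * Order, collection and least numbers *)

Context (hP : Pminus M).

Lemma lt_zeroF x : ~ x ≺ 0_M.
Proof.
by case: (zero_least hP x) => [->|x0 /(lt_trans hP x0)]; apply: lt_irrefl.
Qed.

Lemma lt_succ x : x ≺ x +1.
Proof.
by move: (lt_add hP x (lt01 hP)); rewrite (Defs.addC hP (Defs.one M)) (Defs.addC hP 0_M) (add0 hP).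
Qed.

Lemma lt_succ_inv x y : y ≺ x +1 -> y ≺ x \/ y = x.
Proof.
move=> yx; case: (lt_total hP x y) => [xy|[->|yx']]; [|by right|by left].
case: (lt_irrefl hP (x := y)); apply: (lt_trans hP yx).
have [z Ez] := lt_diff hP xy.
have z0 : 0_M ≺ z.
  by case: (zero_least hP z) => // z0; move: xy; rewrite -Ez z0 (add0 hP) => /(lt_irrefl hP).
case: (one_least hP z0) => [z1|z1]; first by move: yx; rewrite -Ez z1 => /(lt_irrefl hP).
by rewrite -Ez ![Defs.add x _](Defs.addC hP); apply: lt_add.
Qed.

Lemma lt_ub (a b : M) : exists c, a ≺ c /\ b ≺ c.
Proof.
case: (lt_total hP a b) => [ab|[->|ba]].
- by exists (b +1); split; [apply: (lt_trans hP ab)|]; apply: lt_succ.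
- by exists (b +1); split; apply: lt_succ.
- by exists (a +1); split; [|apply: (lt_trans hP ba)]; apply: lt_succ.
Qed.

(** The form in which collection is used. A bounded quantifier of the leading kind is absorbed by
    [arith_exB] and [arith_allB]; this handles the opposite kind. *)
Definition bounded_closed n := forall R j, arith true n R ->
  arith true n (fun v => forall a, a ≺ v j -> R (a .: v)).

(** Both kinds [s] are included because [least_numberS] swaps them when it descends a level. *)
Definition least_number n := forall s R v, arith s n R -> (exists x, R (x .: v)) ->
  exists x, R (x .: v) /\ forall y, y ≺ x -> ~ R (y .: v).

Lemma pi_exB n R j : bounded_closed n -> arith false n R ->
  arith false n (fun v => exists a, a ≺ v j /\ R (a .: v)).
Proof.
move=> Bn /arithN/(Bn _ j)/arith_iff H; apply: arithNN; apply: H => v.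
split=> [H [a [/H]] //|H a lta Ra]; apply: H; by exists a.
Qed.

(* A block of existential quantifiers collapses to one: b bounds the block. *)
Lemma normal_form n R : bounded_closed n -> arith true n.+1 R ->
  exists Q, [/\ arith false n Q, forall v a b, a ≺ b -> Q (a .: v) -> Q (b .: v)
    & forall v, R v <-> exists b, Q (b .: v)].
Proof.
move=> Bn; move: R; apply: (@sigma_ind n) => R.
  move=> HR; exists (fun v => R (fun j => v j.+1)); split=> // [|v].
    exact: arith_tail.
  by split=> [Rv|[]] //; exists 0_M.
move=> [Q [HQ Qmono RQ]].
exists (fun v => exists a, a ≺ v 0 /\ Q (v 0 .: a .: (fun j => v (1 + j)))); split.
- exact: (pi_exB 0 Bn (arith_subst [:: 1; 0] 2 HQ)).
- move=> v b c bc [a [ab Qb]]; exists a; split; first exact: (lt_trans hP ab).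
  exact: Qmono Qb.
- move=> v; split=> [[a /RQ [b Qb]]|[b [a [_ Qb]]]]; last by exists a; apply/RQ; exists b.
  have [c [ac bc]] := lt_ub a b.
  by exists c, a; split=> //; apply: Qmono Qb.
Qed.

(** * From pigeonhole to unions, one level *)

Lemma full_set : Delta1_comprehension M -> is_set (fun _ : M => True).
Proof.
move=> CA; have [|||X [X_set EX]] := CA (Eq M Zero Zero) (Eq M Zero Zero) (fun=> 0_M).
- by exists 0, (Eq M Zero Zero).
- by exists 0, (Eq M Zero Zero).
- by [].
have -> // : (fun=> True) = X.
by apply: functional_extensionality => x; apply: propositional_extensionality; rewrite EX.
Qed.

Lemma unions_of_pigeonhole n : Delta1_comprehension M ->
  bounded_closed n -> least_number n ->
  infinite_pigeonhole (@Sigma M n.+1) -> finite_unions_finite (@Sigma M n.+1).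
Proof.
move=> CA Bn Ln PHP A k [p [v [Hp EA]]] finA; apply: NNPP => infU.
have [Q [HQ Qmono EQ]] : exists Q, [/\ arith false n Q,
    forall v a b, a ≺ b -> Q (a .: v) -> Q (b .: v)
    & forall v, sat v p <-> exists b, Q (b .: v)].
  by apply: normal_form => //; exists p.
(* Valuations: E is read at i .: D .: w .: k .: v, and T at D .: w .: k .: v. *)
pose E (u : nat -> M) := exists x, x ≺ u 1 /\
  (~ x ≺ u 2 /\ Q (u 1 .: u 0 .: x .: (fun j => u (4 + j)))).
pose T (u : nat -> M) := exists i, i ≺ u 2 /\ E (i .: u).
have HE : arith false n E.
  exact: (pi_exB 1 Bn
    (arith_and (arithN (arith_lt true n 0 3)) (arith_subst [:: 2; 1; 0] 5 HQ))).
have HT : arith false n T by exact: (pi_exB 2 Bn HE).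
(* As [Q] is monotone, [D] serves both as bound on [x] and as witness. [E] is Pi_n and the two
   minimality clauses are Sigma_n by [Bn], so the quantifier over [D] makes [C] Sigma_{n+1};
   minimality of [D] and [i] makes it single-valued. *)
pose C w i := i ≺ k /\ exists D, [/\ E (i .: D .: w .: k .: v),
  forall D', D' ≺ D -> ~ T (D' .: w .: k .: v)
  & forall i', i' ≺ i -> ~ E (i' .: D .: w .: k .: v)].
have exT w : exists D, T (D .: w .: k .: v).
  have [x H] := not_all_ex_not _ _ (fun H => infU (ex_intro _ w H)).
  have [[i [ik /EA/EQ [b Qb]]] wx] := imply_to_and _ _ H.
  have [D [xD bD]] := lt_ub x b.
  by exists D, i; split=> //; exists x; do 2!split=> //; apply: Qmono Qb.
have Ctot w : exists i, C w i.
  have [D [[i0 [i0k E0]] minD]] := Ln _ _ _ HT (exT w).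
  have HE' := arith_and (arith_lt false n 0 3) HE.
  have [|i [[ik Ei] mini]] := Ln _ _ (D .: w .: k .: v) HE'; first by exists i0.
  exists i; split=> //; exists D; split=> // i' i'i Ei'; apply: (mini i' i'i).
  by split=> //; apply: (lt_trans hP i'i).
have C_def : definable2 (@Sigma M n.+1) C.
  (* Under the quantifier over [D] the valuation is [D .: w .: i .: k .: v], so [E] and [T] are
     reindexed. *)
  pose E' (u : nat -> M) := E (u 2 .: u 0 .: u 1 .: (fun j => u (3 + j))).
  pose T' (u : nat -> M) :=
    forall D', D' ≺ u 0 -> ~ T (D' .: u 1 .: (fun j => u (3 + j))).
  pose F' (u : nat -> M) :=
    forall i', i' ≺ u 2 -> ~ E (i' .: u 0 .: u 1 .: (fun j => u (3 + j))).
  have HE' : arith true n.+1 E' := @arith_switch true n _ (arith_subst [:: 2; 0; 1] 3 HE).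
  have HT' : arith true n.+1 T'.
    exact: arithS (Bn _ 0 (arithN (arith_subst [:: 0; 2] 4 HT))).
  have HF' : arith true n.+1 F'.
    exact: arithS (Bn _ 2 (arithN (arith_subst [:: 0; 1; 2] 4 HE))).
  have := arith_definable2 (k .: v)
    (arith_and (arith_lt true n.+1 1 2) (arith_ex (arith_and HE' (arith_and HT' HF')))).
  move=> [q [w [Hq Eq]]]; exists q, w; split=> // x y; rewrite -Eq.
  by split=> -[xk [D H]]; split=> //; exists D; case: H => // ? [].
have [|||||c [ck infc]] := PHP C k (fun=> True) C_def.
- move=> w i i' [ik [D [Ei minD mini]]] [i'k [D' [Ei' minD' mini']]].
  have ED : D = D'.
    by case: (lt_total hP D D') => [/minD' []|[//|/minD []]]; [exists i|exists i'].
  subst D'; by case: (lt_total hP i i') => [/mini' []|[//|/mini []]].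
- by move=> w i [].
- exact: full_set.
- by move=> [b /(_ b I)/(lt_irrefl hP)].
- by move=> w _.
(* If [b] bounds [A c], it bounds the colour class: colour [c] at [w] provides an [x] in [A c] not
   below [w]. *)
have [b Hb] := finA c ck; apply: infc; exists b => w [[_ [D [[x [xD [wx Qx]]] _ _]]] _].
have xb : x ≺ b by apply/Hb/EA/EQ; exists D.
by case: (lt_total hP w x) => [wx'|[->|/wx]] //; apply: lt_trans wx' xb.
Qed.

(** * From unions to collection and least numbers at the next level *)

Lemma uniform_bound n R v k : finite_unions_finite (@Sigma M n) -> arith true n R ->
  (forall i, i ≺ k -> exists b, forall x, R (i .: x .: v) -> x ≺ b) ->
  exists b, forall i x, i ≺ k -> R (i .: x .: v) -> x ≺ b.
Proof.
move=> FU HR Hb; have [b H] := FU _ k (arith_definable2 v HR) Hb.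
by exists b => i x ik Rx; apply: H; exists i.
Qed.

(** Gives the finiteness needed for the union principle: a nonempty upward closed set has a bounded
    complement. *)
Lemma mono_lt_succ Q v b x : (forall c d, c ≺ d -> Q (c .: v) -> Q (d .: v)) ->
  Q (b .: v) -> ~ Q (x .: v) -> x ≺ b +1.
Proof.
move=> Qmono Qb nQx; case: (lt_total hP x b) => [xb|[xb|bx]].
- exact: lt_trans xb (lt_succ b).
- by case: nQx; rewrite xb.
- by case: nQx; apply: Qmono Qb.
Qed.

Lemma bounded_closedS n : finite_unions_finite (@Sigma M n.+1) ->
  bounded_closed n -> bounded_closed n.+1.
Proof.
move=> FU Bn R j /(normal_form Bn) [Q [HQ Qmono EQ]].
have H : arith true n.+1 (fun v => exists b, forall a, a ≺ v j -> Q (b .: a .: v)).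
  exact: (arith_ex (@arith_switch true n _ (arith_allB j.+1 (arith_subst [:: 1; 0] 2 HQ)))).
apply: (arith_iff H) => v; split=> [[b Hb] a lta|{}H].
  by apply/EQ; exists b; apply: Hb.
(* The sets to unite consist, for each [a], of the [b] that fail [Q]. A common strict bound of all
   failures cannot itself fail. *)
have [|b Hb] := uniform_bound (v := v) (k := v j) FU
  (arithS (arithN (arith_subst [:: 1; 0] 2 HQ))).
  move=> a lta; have /EQ [b Qb] := H a lta.
  by exists (b +1) => x; apply: mono_lt_succ Qb; apply: Qmono.
exists b => a lta; apply: NNPP => nQ.
exact: (lt_irrefl hP (Hb a b lta nQ)).
Qed.

(* Below k, a Sigma_{n+1} relation agrees with a Pi_n one: apply the union
   principle to the sets of non-bounds of witnesses for each x in the relation. *)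
Lemma sigma_cutoff n R v k : finite_unions_finite (@Sigma M n.+1) ->
  bounded_closed n -> arith true n.+1 R ->
  exists Q b, arith false n Q /\ forall x, x ≺ k -> (R (x .: v) <-> Q (x .: b .: v)).
Proof.
move=> FU Bn HR; have [Q [HQ Qmono EQ]] := normal_form Bn HR.
(* The conjunct [R] empties the set of non-bounds when [x] has no witness, so that it is finite for
   every [x]. *)
have [|b Hb] := uniform_bound (v := v) (k := k) FU
  (arith_and (arithS (arithN (arith_subst [:: 1; 0] 2 HQ))) (arith_subst [:: 0] 2 HR)).
  move=> x _; have [/EQ [b Qb]|nRx] := classic (R (x .: v)).
    by exists (b +1) => y [nQ _]; apply: mono_lt_succ Qb nQ; apply: Qmono.
  by exists 0_M => y [_ /nRx].
exists (fun u => Q (u 1 .: u 0 .: (fun j => u (2 + j)))), b; split.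
  exact: (arith_subst [:: 1; 0] 2 HQ).
move=> x xk; split=> [Rx|Qb]; last by apply/EQ; exists b.
by apply: NNPP => nQ; apply: (lt_irrefl hP (Hb x b xk _)).
Qed.

(** Up to a known element [x0], [R] agrees with a relation one level lower, of the opposite kind,
    whose minimum is at most [x0] and hence is that of [R]. *)
Lemma least_numberS n : finite_unions_finite (@Sigma M n.+1) ->
  bounded_closed n -> least_number n -> least_number n.+1.
Proof.
move=> FU Bn Ln s R v HR [x0 Rx0].
have [S [b [HS ES]]] : exists S b, arith (~~ s) n S /\
    forall x, x ≺ x0 +1 -> (R (x .: v) <-> S (x .: b .: v)).
  case: s HR => [/(sigma_cutoff v (x0 +1) FU Bn) //|/arithN].
  move=> /(sigma_cutoff v (x0 +1) FU Bn) [Q [b [HQ EQ]]].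
  exists (fun u => ~ Q u), b; split=> [|x /EQ <-]; first exact: arithN HQ.
  by split=> [Rx []|/NNPP].
have [|x [Sx minx]] := Ln _ _ (b .: v) HS.
  by exists x0; apply/ES => //; apply: lt_succ.
have xx0 : x ≺ x0 +1.
  case: (lt_total hP x x0) => [xx0|[->|/minx []]]; last by apply/ES => //; apply: lt_succ.
    exact: lt_trans xx0 (lt_succ x0).
  exact: lt_succ.
exists x; split=> [|y yx /ES H]; first exact/ES.
by apply: (minx y yx); apply: H; apply: lt_trans yx xx0.
Qed.

(** * The induction on levels *)

Lemma bounded_closed0 : bounded_closed 0.
Proof.
move=> R j [p [Hp ER]]; exists (AllB (Var j) p); split=> // v.
by split=> H a /H /ER.
Qed.

Lemma least_number0 : IDelta0 M -> least_number 0.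
Proof.
move=> ID s R v [p [/hier0 Hp ER]] [x0 Rx0]; apply: NNPP => nomin.
(* Skips index 1, the bound [x], so that the formula can be read under the bounded quantifier in
   [below], where Delta0 induction on [x] is course-of-values induction. *)
pose r j := if j is i.+1 then i.+2 else 0.
have Er x y : sat (y .: x .: v) (ren r p) <-> R (y .: v).
  rewrite sat_ren ER; suff -> : (fun j => (y .: x .: v) (r j)) = y .: v by [].
  by apply: functional_extensionality; case.
have below x : sat (x .: v) (AllB (Var 0) (Neg (ren r p))).
  apply: ID => /= [|y /lt_zeroF //|{}x IH y /lt_succ_inv [/IH|->]].
  - exact: Delta0_ren.
  - by rewrite !Er.
  - by rewrite Er => Rx; apply: nomin; exists x; split=> // z /IH; rewrite Er.
apply: nomin; exists x0; split=> // y yx0 Ry.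
by apply: (below x0 y yx0); apply/Er.
Qed.

Lemma pigeonholeW n : infinite_pigeonhole (@Sigma M n.+1) -> infinite_pigeonhole (@Sigma M n).
Proof.
move=> PHP C k X [p [v [Hp EC]]]; apply: PHP.
by exists p, v; split=> //; apply: (hier_succ (s := true)).
Qed.

(** The union principle at level [n.+1] uses the closure properties only at level [n], and in turn
    yields them at [n.+1]. *)
Lemma pigeonhole_induction n : IDelta0 M -> Delta1_comprehension M ->
  infinite_pigeonhole (@Sigma M n) -> bounded_closed n /\ least_number n.
Proof.
move=> ID CA; elim: n => [|n IH] PHP.
  by split; [apply: bounded_closed0|apply: least_number0].
have [Bn Ln] := IH (pigeonholeW PHP).
have FU := unions_of_pigeonhole CA Bn Ln PHP.
by split; [apply: bounded_closedS|apply: least_numberS].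
Qed.

(** * From unions to pigeonhole *)

(** The colour classes within [X] are uniformly definable and cover [X]; were they all finite, so
    would [X] be. *)
Lemma pigeonhole_of_unions n :
  finite_unions_finite (@Sigma M n) -> infinite_pigeonhole (@Sigma M n).
Proof.
move=> FU C k X [p [v [Hp EC]]] _ Ck X_set infX domX; apply: NNPP => noc; apply: infX.
have HC : arith true n (fun u => sat u p) by exists p.
have HX := arith_Delta0 true n (p := Defs.Mem (Var 1) (exist _ X X_set)) I.
(* The swap [[:: 1; 0]] is due to [C] taking the element first, while a family takes the index
   first. *)
have := arith_definable2 v (arith_and (arith_subst [:: 1; 0] 2 HC) HX).
move=> /(FU _ k) [|b Hb].
  move=> c ck; apply: NNPP => infc; apply: noc; exists c; split=> // -[b Hb].
  by apply: infc; exists b => x [/EC Cx Xx]; apply: Hb.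
exists b => x Xx; have [c Cx] := domX x Xx.
by apply: Hb; exists c; split; [apply: Ck Cx|split=> //; apply/EC].
Qed.

End Definability.

Theorem theorem9 (M : so_structure) (n : nat) (hF : RCA0star M) :
  (finite_unions_finite (@Sigma M n.+1) -> infinite_pigeonhole (@Sigma M n.+1))
  /\
  (BSigma M n ->
   infinite_pigeonhole (@Sigma M n.+1) -> finite_unions_finite (@Sigma M n.+1)).
Proof.
case: hF => hP ID _ CA; split=> [|_ PHP]; first exact: pigeonhole_of_unions.
have [Bn Ln] := pigeonhole_induction hP ID CA (pigeonholeW PHP).
exact: unions_of_pigeonhole.
Qed.
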